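(* Let $X$ be an $r$-normed quasi-Banach function lattice over $(\mathcal P,\mu)$ for some $r\in(0,\infty)$, and assume that all functions in $N^1X$ are quasi-continuous. Then $\widetilde C_{X,r}$ is an outer capacity, i.e. $$\widetilde C_{X,r}(E)=\inf\{\widetilde C_{X,r}(G): G\supset E,\ G\text{ open}\}\quad\text{for every }E\subset\mathcal P.$$ Moreover, if $X$ is normed (i.e. $\|\cdot\|_X$ satisfies the triangle inequality with constant $1$), then $C_X$ is an outer capacity, i.e. $C_X(E)=\inf\{C_X(G):G\supset E,\ G\text{ open}\}$ for every $E\subset\mathcal P$.
   Context: Setting. $\mathcal P=(\mathcal P,\mathrm d,\mu)$ is a metric space with a $\sigma$-finite Borel regular measure $\mu$ (all Borel sets are $\mu$-measurable, and every $\mu$-measurable set $A$ is contained in a Borel set $D$ with $\mu(D)=\mu(A)$) such that every ball has finite positive measure. $\mathcal M(\mathcal P,\mu)$ is the set of all extended real-valued $\mu$-measurable functions on $\mathcal P$ (defined everywhere). Quasi-Banach function lattice: a linear space $X=\{u\in\mathcal M(\mathcal P,\mu):\|u\|_X<\infty\}$ given by a functional $\|\cdot\|_X:\mathcal M(\mathcal P,\mu)\to[0,\infty]$ such that: $\|u\|_X=0$ iff $u=0$ a.e.; $\|au\|_X=|a|\,\|u\|_X$ for $a\in\mathbb R$; there is a constant $c_\triangle\ge1$ (modulus of concavity) with $\|u+v\|_X\le c_\triangle(\|u\|_X+\|v\|_X)$; if $|u|\le|v|$ a.e. then $\|u\|_X\le\|v\|_X$; and (Riesz--Fischer) if $u_n\ge0$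 a.e. for all $n$ then $\|\sum_{n=1}^\infty u_n\|_X\le\sum_{n=1}^\infty c_\triangle^n\|u_n\|_X$. The quasi-norm is also assumed continuous: $\|u_n-u\|_X\to0$ implies $\|u_n\|_X\to\|u\|_X$. $X$ is $r$-normed if $\|u+v\|_X^r\le\|u\|_X^r+\|v\|_X^r$ for all $u,v$. Newtonian space. A curve is a non-constant continuous map $\gamma$ from a compact interval into $\mathcal P$ of finite length, parametrized by arc length $ds$ on $[0,l_\gamma]$. A Borel function $g:\mathcal P\to[0,\infty]$ is an upper gradient of $u:\mathcal P\to[-\infty,\infty]$ if $|u(\gamma(0))-u(\gamma(l_\gamma))|\le\int_\gamma g\,ds$ for every curve $\gamma$, with the convention $|(\pm\infty)-(\pm\infty)|=\infty$. Set $\|u\|_{N^1X}=\|u\|_X+\inf_g\|g\|_X$, infimum over all upper gradients $g$ of $u$, and $N^1X=\{u\in\mathcal M(\mathcal P,\mu):\|u\|_{N^1X}<\infty\}$ (a quasi-seminormed space of everywhere defined functions). Capacities. For $E\subset\mathcal P$: $C_X(E)=\inf\{\|u\|_{N^1X}:u\ge1\text{ on }E\}$; and, if $X$ is $r$-normed, $\widetilde C_{X,r}(E)=\inf\{(\|u\|_X^r+\|g\|_X^r)^{1/r}: u\ge1\text{ on }E\text{ and }g\text{ is an upper gradient of }u\}$. A function $u:\mathcal P\to[-\infty,\infty]$ is quasi-continuous if for every $\varepsilon>0$ there is an open set $E\subset\mathcal P$ with $C_X(E)<\varepsilon$ such that $u|_{\mathcal P\setminus E}$ is continuous (and real-valued).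 (Using $\widetilde C_{X,r}$ instead of $C_X$ gives the same notion.) *)

(* Defs.v *)
From HB Require Import structures.
From mathcomp Require Import all_boot all_order all_algebra.
From mathcomp Require Import all_classical all_reals all_analysis.
From mathcomp Require Import measurable_realfun.
Set Implicit Arguments.
Unset Strict Implicit.
Unset Printing Implicit Defensive.
Import Order.TTheory GRing.Theory Num.Theory.
Import numFieldNormedType.Exports.
Local Open Scope classical_set_scope.
Local Open Scope ring_scope.

(* The topology comes from the metric; the sigma-algebra is independent of it
   and plays the role of the mu-measurable sets. *)
#[short(type="metricMeasurableType")]
HB.structure Definition MetricMeasurable d (R : numDomainType) :=
  {T of Metric R T & Measurable d T}.

Section defs.
Context {d : measure_display} {R : realType} {P : metricMeasurableType d R}.

Definition borel : set (set P) := <<s @open P >>.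

Definition borel_regular (mu : set P -> \bar R) : Prop :=
  borel `<=` measurable /\
  forall A, measurable A -> exists D, [/\ borel D, A `<=` D & mu D = mu A].

Definition balls_finite_positive (mu : set P -> \bar R) : Prop :=
  forall (x : P) (e : R), 0 < e -> (0 < mu (ball x e) < +oo)%E.

Local Open Scope ereal_scope.

(* [nX] is a total function, but only its values on measurable functions are
   ever used.  The library's [+oo - +oo = -oo] on sums is harmless: functions
   of finite quasi-norm are finite a.e.  In the Riesz-Fischer property the sum
   of the series is determined only a.e., hence the representative [s]. *)
Record quasi_Banach_function_lattice (mu : {measure set P -> \bar R}) (c : R)
    (nX : (P -> \bar R) -> \bar R) : Prop := {
  qnorm_ge0 : forall u : P -> \bar R, measurable_fun setT u -> 0 <= nX u ;
  qnorm_eq0 : forall u : P -> \bar R, measurable_fun setT u ->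
    (nX u = 0 <-> {ae mu, forall x, u x = 0}) ;
  qnormZ : forall (a : R) (u : P -> \bar R), measurable_fun setT u ->
    nX (fun x => a%:E * u x) = `|a|%:E * nX u ;
  modulus_ge1 : (1 <= c)%R ;
  qnormD : forall u v : P -> \bar R,
    measurable_fun setT u -> measurable_fun setT v ->
    nX (u \+ v) <= c%:E * (nX u + nX v) ;
  qnorm_lattice : forall u v : P -> \bar R,
    measurable_fun setT u -> measurable_fun setT v ->
    {ae mu, forall x, `|u x| <= `|v x|} -> nX u <= nX v ;
  qnorm_Riesz_Fischer : forall (u : nat -> P -> \bar R) (s : P -> \bar R),
    (forall n, measurable_fun setT (u n)) -> measurable_fun setT s ->
    (forall n, {ae mu, forall x, 0 <= u n x}) ->
    {ae mu, forall x, s x = \sum_(1 <= n <oo) u n x} ->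
    nX s <= \sum_(1 <= n <oo) (c ^+ n)%:E * nX (u n) ;
  qnorm_continuous : forall (u : nat -> P -> \bar R) (v : P -> \bar R),
    (forall n, measurable_fun setT (u n)) -> measurable_fun setT v ->
    nX (u n \- v) @[n --> \oo] --> 0 -> nX (u n) @[n --> \oo] --> nX v }.

Definition r_normed (nX : (P -> \bar R) -> \bar R) (r : R) : Prop :=
  forall u v : P -> \bar R, measurable_fun setT u -> measurable_fun setT v ->
    nX (u \+ v) `^ r <= nX u `^ r + nX v `^ r.

Definition normed (nX : (P -> \bar R) -> \bar R) : Prop :=
  forall u v : P -> \bar R, measurable_fun setT u -> measurable_fun setT v ->
    nX (u \+ v) <= nX u + nX v.

Definition curve_length (gamma : R -> P) (a b : R) : \bar R :=
  ereal_sup [set (\sum_(0 <= n < size s)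
      mdist (gamma (nth b (a :: s) n)) (gamma (nth b (a :: s) n.+1)))%:E |
    s in itv_partition a b].

(* Nonconstant rectifiable curves in their arc-length parametrization, [l]
   being the length; [gamma] is irrelevant outside [0, l]. *)
Definition is_curve (l : R) (gamma : R -> P) : Prop :=
  [/\ (0 <= l)%R,
      {within `[0%R, l], continuous gamma},
      exists t t',
        [/\ t \in `[0%R, l], t' \in `[0%R, l] & gamma t <> gamma t'] &
      forall t, t \in `[0%R, l] -> curve_length gamma 0 t = t%:E].

(* No special case is needed for [|(+oo) - (+oo)| = +oo] and the like: the
   library sets [+oo - +oo = -oo - -oo = -oo]. *)
Definition upper_gradient (u g : P -> \bar R) : Prop :=
  [/\ measurable_fun setT (g : g_sigma_algebraType (@open P) -> \bar R),
      forall x, 0 <= g x &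
      forall l gamma, is_curve l gamma ->
        `|u (gamma 0%R) - u (gamma l)| <=
          \int[lebesgue_measure]_(t in `[0%R, l]) g (gamma t)].

Definition N1norm (nX : (P -> \bar R) -> \bar R) (u : P -> \bar R) : \bar R :=
  nX u + ereal_inf [set nX g | g in upper_gradient u].

Definition N1 (nX : (P -> \bar R) -> \bar R) : set (P -> \bar R) :=
  [set u | measurable_fun setT u /\ N1norm nX u < +oo].

Definition capacity (nX : (P -> \bar R) -> \bar R) (E : set P) : \bar R :=
  ereal_inf [set N1norm nX u | u in
    [set u | measurable_fun setT u /\ forall x, E x -> 1 <= u x]].

Definition capacity_r (nX : (P -> \bar R) -> \bar R) (r : R) (E : set P)
    : \bar R :=
  ereal_inf [set (nX ug.1 `^ r + nX ug.2 `^ r) `^ r^-1 | ug in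
    [set ug : (P -> \bar R) * (P -> \bar R) |
      [/\ measurable_fun setT ug.1, forall x, E x -> 1 <= ug.1 x &
          upper_gradient ug.1 ug.2]]].

Definition quasicontinuous (nX : (P -> \bar R) -> \bar R) (u : P -> \bar R)
    : Prop :=
  forall e : R, (0 < e)%R -> exists E : set P,
    [/\ open E, capacity nX E < e%:E,
        {within ~` E, continuous u} &
        forall x, ~ E x -> u x \is a fin_num].

Definition outer_capacity (C : set P -> \bar R) : Prop :=
  forall E, C E = ereal_inf [set C G | G in [set G | open G /\ E `<=` G]].

End defs.

(* Main.v *)
(** Given an admissible pair (u, g) for E, the function |u| is quasi-continuous
    and |u| >= 1 on E, so for every a > 1 the set {a |u| > 1} becomes open after
    adjoining an open set V of small capacity.  Adding to a |u| a function v >= 0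
    of small norm with v >= 1 on V gives a function admissible for this open
    set, at a cost close to that of u when a is close to 1. *)
Require Import Defs.
From HB Require Import structures.
From mathcomp Require Import all_boot all_order all_algebra.
From mathcomp Require Import all_classical all_reals all_analysis.
From mathcomp Require Import measurable_realfun.
Import Order.TTheory GRing.Theory Num.Theory.
Import numFieldNormedType.Exports.
Local Open Scope classical_set_scope.
Local Open Scope ring_scope.

(** * Inequalities in the extended reals *)

Local Open Scope ereal_scope.

(** Because [+oo - +oo = -oo], a distance with an infinite argument equals [+oo], so only the real
    case has content. *)
Lemma abse_dist_abse {R : realDomainType} (x y : \bar R) :
  `| `|x| - `|y| | <= `|x - y|.
Proof.
move: x y => [x| |] [y| |] //=.
by rewrite lee_fin; exact: ler_dist_dist.
Qed.

Lemma ge0_abse_distD {R : realDomainType} (x y z t : \bar R) :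
  0 <= x -> 0 <= y -> 0 <= z -> 0 <= t ->
  `|(x + y) - (z + t)| <= `|x - z| + `|y - t|.
Proof.
move: x y z t => [x| |] [y| |] [z| |] [t| |] //= _ _ _ _.
by rewrite lee_fin opprD addrACA ler_normD.
Qed.

Lemma abse_distZl {R : realDomainType} (a : R) (x y : \bar R) : (0 < a)%R ->
  `|a%:E * x - a%:E * y| = a%:E * `|x - y|.
Proof.
move=> a0; move: x y => [x| |] [y| |] //=;
  rewrite ?gt0_muley ?gt0_muleNy ?lte_fin //=.
by rewrite -EFinM -mulrBr normrM gtr0_norm.
Qed.

(** Passes to the limit [s -> 1], [e -> 0]; both capacity estimates end this way. *)
Lemma lee_limit_scale_add {R : realFieldType} (x y : \bar R) : 0 <= y ->
  (forall s e : R, (1 < s)%R -> (0 < e)%R -> x <= s%:E * y + e%:E) -> x <= y.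
Proof.
case: y => [y| |] //=; last by move=> *; rewrite leey.
rewrite lee_fin => y0 H; apply/lee_addgt0Pr => e e0.
have y1 : (0 < y + 1)%R by rewrite ltr_wpDl.
have h0 : (0 < e / 2)%R by rewrite divr_gt0.
(* This [s] makes [(s - 1) * y] at most [e / 2]; the denominator [y + 1] stays positive when
   [y = 0]. *)
apply: le_trans (H (1 + e / 2 / (y + 1))%R (e / 2)%R _ h0) _.
  by rewrite ltrDl divr_gt0.
rewrite -EFinM -!EFinD lee_fin mulrDl mul1r -addrA lerD2l.
rewrite [leRHS](splitr e) lerD2r -(mulrA (e / 2)%R) ler_piMr ?(ltW h0) //.
by rewrite mulrC ler_pdivrMr // mul1r lerDl.
Qed.

(** * Calculus of upper gradients *)

Section upper_gradient_theory.
Context {d : measure_display} {R : realType} {P : metricMeasurableType d R}.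
Implicit Types u v g h : P -> \bar R.

(** Preimages of open sets under [gamma] are relatively open in [[0, l]], hence measurable. This
    licenses linearity of the curve integral. *)
Lemma measurable_borel_curve {l : R} {gamma : R -> P} {g} :
  is_curve l gamma ->
  measurable_fun setT (g : g_sigma_algebraType (@open P) -> \bar R) ->
  measurable_fun `[0%R, l] (g \o gamma).
Proof.
move=> [_ gamma_cont _ _] mg.
apply: (@measurableT_comp _ _ _ _ (g_sigma_algebraType (@open P))) => //.
apply: (@measurability _ _ _ (g_sigma_algebraType (@open P)) _ _ (@open P)) => //.
move=> _ [U oU <-].
apply: open_measurable_subspace => //.
by move/continuousP : gamma_cont; apply.
Qed.

(** Upper gradients are Borel, while the lattice axioms speak of the sigma-algebra of [P], which
    contains the Borel sets. *)
Lemma upper_gradient_measurable {mu : set P -> \bar R} {u g} :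
  borel_regular mu -> upper_gradient u g -> measurable_fun setT g.
Proof.
move=> [borel_meas _] [mg _ _] mT A mA.
by apply: borel_meas; exact: mg.
Qed.

Lemma upper_gradient_abse {u g} : upper_gradient u g ->
  upper_gradient (abse \o u) g.
Proof.
move=> [mg g0 ug]; split => // l gamma cg.
exact: le_trans (abse_dist_abse _ _) (ug _ _ cg).
Qed.

Lemma upper_gradientZ {a : R} {u g} : (0 < a)%R -> upper_gradient u g ->
  upper_gradient (fun x => a%:E * u x) (fun x => a%:E * g x).
Proof.
move=> a0 [mg g0 ug]; split.
- exact: measurable_funeM.
- by move=> x; rewrite mule_ge0 // lee_fin ltW.
- move=> l gamma cg; rewrite abse_distZl //.
  rewrite ge0_integralZl_EFin ?(ltW a0) //.
  + by rewrite lee_pmul2l // ?lte_fin //; exact: ug.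
  + exact: measurable_borel_curve cg mg.
Qed.

Lemma upper_gradientD {u v g h} : (forall x, 0 <= u x) -> (forall x, 0 <= v x) ->
  upper_gradient u g -> upper_gradient v h ->
  upper_gradient (u \+ v) (g \+ h).
Proof.
move=> u0 v0 [mg g0 ug] [mh h0 vh]; split.
- exact: emeasurable_funD.
- by move=> x; rewrite adde_ge0.
- move=> l gamma cg; apply: le_trans (ge0_abse_distD _ _ _ _ _ _ _ _) _ => //.
  rewrite ge0_integralD //; first by rewrite leeD ?ug ?vh.
  + exact: measurable_borel_curve cg mg.
  + exact: measurable_borel_curve cg mh.
Qed.

End upper_gradient_theory.

(** * Monotone capacities and relatively open sets *)

Section outer_capacity_criterion.
Context {d : measure_display} {R : realType} {P : metricMeasurableType d R}.

(** Monotonicity alone bounds [C E] by the infimum over open supersets, which leaves the converse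
    inequality. *)
Lemma outer_capacityP (C : set P -> \bar R) :
  (forall A B, A `<=` B -> C A <= C B) ->
  (forall E, ereal_inf [set C G | G in [set G | open G /\ E `<=` G]] <= C E) ->
  outer_capacity C.
Proof.
move=> C_mono C_out E; apply/eqP; rewrite eq_le C_out andbT.
by apply: le_ereal_inf_tmp => _ [G [_ EG] <-]; exact: C_mono.
Qed.

Lemma capacity_mono (nX : (P -> \bar R) -> \bar R) (A B : set P) :
  A `<=` B -> capacity nX A <= capacity nX B.
Proof.
move=> AB; apply: ereal_inf_le_tmp => _ [u [meas_u u1] <-].
by exists u => //; split => // x /AB/u1.
Qed.

Lemma capacity_r_mono (nX : (P -> \bar R) -> \bar R) (r : R) (A B : set P) :
  A `<=` B -> capacity_r nX r A <= capacity_r nX r B.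
Proof.
move=> AB; apply: ereal_inf_le_tmp => _ [ug [m1 u1 ugr] <-].
by exists ug => //; split => // x /AB/u1.
Qed.

(** The preimage of [U] agrees off [V] with some open [W], so adjoining [V] to either set gives the
    same open union. *)
Lemma within_continuous_openU (u : P -> \bar R) (V : set P)
    (U : set (\bar R)) :
  open U -> open V -> {within ~` V, continuous u} -> open (u @^-1` U `|` V).
Proof.
move=> oU oV /continuousP /(_ _ oU) /open_subspaceP [W oW WV].
suff -> : u @^-1` U `|` V = W `|` V by exact: openU.
apply/seteqP; split => x [xU|xV]; try by right.
- have [xV|xV] := pselect (V x); first by right.
  by left; have [] : (W `&` ~` V) x by rewrite WV.
- have [xV|xV] := pselect (V x); first by right.
  by left; have [] : (u @^-1` U `&` ~` V) x by rewrite -WV.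
Qed.

End outer_capacity_criterion.

(** * Open supersets at almost the same cost, and outer regularity *)

Section open_enlargement.
Context {d : measure_display} {R : realType} {P : metricMeasurableType d R}.
Context {mu : {measure set P -> \bar R}} {c : R} {nX : (P -> \bar R) -> \bar R}.
Hypothesis mu_borel_regular : borel_regular mu.
Hypothesis nX_lattice : quasi_Banach_function_lattice mu c nX.

Lemma qnorm_abse {u : P -> \bar R} : measurable_fun setT u ->
  nX (abse \o u) <= nX u.
Proof.
move=> meas_u; apply: (qnorm_lattice nX_lattice) => //.
  by apply: measurableT_comp => //; exact: abse_measurable.
by apply: aeW => x; rewrite /= abse_id.
Qed.

Lemma upper_gradient_qnorm_ge0 {u g : P -> \bar R} :
  upper_gradient u g -> 0 <= nX g.
Proof.
move=> /(upper_gradient_measurable mu_borel_regular).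
exact: qnorm_ge0 nX_lattice _.
Qed.

Lemma capacity_lt_witness {E : set P} {e : R} : capacity nX E < e%:E ->
  exists v h, [/\ measurable_fun setT v, forall x, 0 <= v x,
    forall x, E x -> 1 <= v x, upper_gradient v h & nX v + nX h < e%:E].
Proof.
move=> /ereal_inf_lt [_ [v [mv v1] <-]].
rewrite /N1norm => vh.
have nv0 := qnorm_ge0 nX_lattice mv.
(* Finiteness allows [nX v] to be moved across the strict inequality, which then yields one gradient
   [h] from the infimum. *)
have nvfin : nX v \is a fin_num.
  rewrite ge0_fin_numE //; apply: le_lt_trans (lt_trans vh (ltry _)).
  apply: leeDl; apply: le_ereal_inf_tmp => _ [h vh' <-].
  exact: upper_gradient_qnorm_ge0 vh'.
move: vh; rewrite -lteBrDl // => /ereal_inf_lt [_ [h vh <-]].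
rewrite lteBrDl // => vhe.
(* The absolute value secures nonnegativity, keeps [h] as an upper gradient and does not increase
   the quasi-norm. *)
exists (abse \o v), h; split.
- by apply: measurableT_comp => //; exact: abse_measurable.
- by move=> x; exact: abse_ge0.
- move=> x /v1 h1; apply: le_trans h1 _; exact: lee_abs.
- exact: upper_gradient_abse.
- by apply: le_lt_trans vhe; apply: leeD => //; exact: qnorm_abse.
Qed.

Hypothesis N1_quasicontinuous : forall u, N1 nX u -> quasicontinuous nX u.

(** The bounds for [u'], [v] and for [g'], [h] are kept separate, so that either the triangle
    inequality or its [r]-th power form can be applied to the sums afterwards. *)
Lemma open_enlargement {E : set P} {u g : P -> \bar R} {a e : R} :
  (1 < a)%R -> (0 < e)%R -> measurable_fun setT u ->
  (forall x, E x -> 1 <= u x) -> upper_gradient u g ->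
  nX u < +oo -> nX g < +oo ->
  exists G u' g' v h,
    [/\ [/\ open G, E `<=` G & forall x, G x -> 1 <= u' x + v x],
        [/\ measurable_fun setT u', measurable_fun setT v,
            measurable_fun setT g' & measurable_fun setT h],
        upper_gradient (u' \+ v) (g' \+ h),
        nX u' <= a%:E * nX u /\ nX g' = a%:E * nX g &
        nX v + nX h < e%:E].
Proof.
move=> a1 e0 meas_u u1 ug nu ng.
have a0 : (0 < a)%R by exact: lt_trans a1.
have mabs : measurable_fun setT (abse \o u).
  by apply: measurableT_comp => //; exact: abse_measurable.
have mg := upper_gradient_measurable mu_borel_regular ug.
have ug' := upper_gradient_abse ug.
have /N1_quasicontinuous /(_ _ e0) [V [oV CV cV _]] : N1 nX (abse \o u).
  split => //; rewrite /N1norm; apply: lte_add_pinfty.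
    exact: le_lt_trans (qnorm_abse meas_u) nu.
  by apply: le_lt_trans ng; apply: ereal_inf_lbound; exists g.
have [v [h [mv v0 v1 vh vhe]]] := capacity_lt_witness CV.
exists ((abse \o u) @^-1` [set y | a^-1%:E < y] `|` V),
  (fun x => a%:E * (abse \o u) x), (fun x => a%:E * g x), v, h; split => //.
- split.
  + apply: within_continuous_openU oV cV; exact: open_ereal_gt_ereal.
  (* The threshold [a^-1] lies strictly below 1, so the strict inequality defining the open set
     holds on all of [E]. *)
  + move=> x /u1 ux; left; apply: (@lt_le_trans _ _ 1).
      by rewrite lte_fin invf_lt1.
    exact: le_trans ux (lee_abs _).
  + move=> x [/= ux|/v1 vx].
      rewrite -[1]adde0 leeD //.
      by rewrite muleC -lee_pdivrMr // mul1e ltW.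
    rewrite -[1]add0e leeD // mule_ge0 //; last exact: abse_ge0.
    by rewrite lee_fin ltW.
- split => //; try exact: measurable_funeM.
  exact: upper_gradient_measurable mu_borel_regular vh.
- apply: upper_gradientD => //.
    by move=> x; rewrite mule_ge0 ?abse_ge0 // lee_fin ltW.
  exact: upper_gradientZ.
- rewrite !(qnormZ nX_lattice) // gtr0_norm //; split => //.
  by rewrite lee_pmul2l // ?lte_fin //; exact: qnorm_abse.
Qed.

(** With constant 1 in the triangle inequality, the enlarged pair costs at most
    [a * (nX u + nX g) + e]. *)
Lemma capacity_outer : normed nX -> outer_capacity (capacity nX).
Proof.
move=> nX_normed; apply: outer_capacityP; first exact: capacity_mono.
move=> E; set I := ereal_inf _.
apply: le_ereal_inf_tmp => _ [u [meas_u u1] <-].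
have nu0 := qnorm_ge0 nX_lattice meas_u.
(* Fixing [g] removes the infimum inside [N1norm]. If [nX u] is infinite, so is the sum, since that
   infimum is nonnegative. *)
suff H g : upper_gradient u g -> I <= nX u + nX g.
  rewrite /N1norm; have [nu|] := ltP (nX u) +oo; last first.
    rewrite leye_eq => /eqP ->; rewrite addye ?leey //.
    rewrite -ltNye; apply: (@lt_le_trans _ _ 0) => //.
    apply: le_ereal_inf_tmp => _ [h vh' <-].
    exact: upper_gradient_qnorm_ge0 vh'.
  have nufin : nX u \is a fin_num by rewrite ge0_fin_numE.
  rewrite -leeBlDl //; apply: le_ereal_inf_tmp => _ [g ug <-].
  by rewrite leeBlDl //; exact: H.
move=> ug.
have ng0 := upper_gradient_qnorm_ge0 ug.
apply: lee_limit_scale_add; first exact: adde_ge0.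
move=> a e a1 e0.
have a0 : (0 < a)%R by exact: lt_trans a1.
(* An infinite [nX u] or [nX g] makes the right-hand side [+oo]; otherwise the enlargement
   applies. *)
have [nu|] := ltP (nX u) +oo; last first.
  rewrite leye_eq => /eqP ->.
  by rewrite addye ?gt0_muley ?addye ?leey // -ltNye (lt_le_trans _ ng0).
have [ng|] := ltP (nX g) +oo; last first.
  rewrite leye_eq => /eqP ->.
  by rewrite addey ?gt0_muley ?addye ?leey // -ltNye (lt_le_trans _ nu0).
have [G [u' [g' [v [h [[oG EG G1] [mu' mv mg' mh] wg [nu' ng'] vhe]]]]]] :=
  open_enlargement a1 e0 meas_u u1 ug nu ng.
apply: (@le_trans _ _ (nX (u' \+ v) + nX (g' \+ h))).
  apply: ge_ereal_inf; exists (capacity nX G); first by exists G.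
  apply: ge_ereal_inf; exists (N1norm nX (u' \+ v)).
    by exists (u' \+ v) => //; split => //; exact: emeasurable_funD.
  rewrite /N1norm leeD2l //.
  by apply: ereal_inf_lbound; exists (g' \+ h).
apply: le_trans (leeD (nX_normed _ _ mu' mv) (nX_normed _ _ mg' mh)) _.
rewrite addeACA leeD ?(ltW vhe) //.
by rewrite ge0_muleDr // leeD // ng'.
Qed.

(** The same estimate is carried out on [r]-th powers, where [nX] is subadditive. *)
Lemma capacity_r_outer (r : R) : (0 < r)%R -> r_normed nX r ->
  outer_capacity (capacity_r nX r).
Proof.
move=> r0 nX_r; apply: outer_capacityP; first exact: capacity_r_mono.
move=> E; set I := ereal_inf _.
apply: le_ereal_inf_tmp => _ [[u g] /= [meas_u u1 ug] <-].
have rn0 : r != 0%R by rewrite gt_eqF.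
have powK (x : \bar R) : 0 <= x -> (x `^ r) `^ r^-1 = x.
  by move=> x0; rewrite -poweRrM divff // poweRe1.
have pow_le (s : R) (x y : \bar R) : (0 < s)%R -> 0 <= x -> x <= y ->
    x `^ s <= y `^ s.
  move=> s0 x0 xy; apply: gt0_ler_poweR => //; first exact: ltW.
    by rewrite in_itv /= x0 leey.
  by rewrite in_itv /= (le_trans x0 xy) leey.
have I0 : 0 <= I.
  apply: le_ereal_inf_tmp => _ [G _ <-].
  by apply: le_ereal_inf_tmp => _ [ug' _ <-]; exact: poweR_ge0.
(* Writing [I] as the [1/r]-th power of its [r]-th power leaves a bound on the latter. *)
rewrite -(powK I I0); apply: (pow_le); rewrite ?invr_gt0 ?poweR_ge0 //.
have nu0 := qnorm_ge0 nX_lattice meas_u.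
have ng0 := upper_gradient_qnorm_ge0 ug.
have pnn (x : \bar R) : x `^ r != -oo.
  by rewrite -ltNye (lt_le_trans _ (poweR_ge0 _ _)).
apply: lee_limit_scale_add; first by rewrite adde_ge0 ?poweR_ge0.
move=> s e s1 e0.
have s0 : (0 < s)%R by exact: lt_trans s1.
have [nu|] := ltP (nX u) +oo; last first.
  rewrite leye_eq => /eqP ->.
  by rewrite poweRyr // addye ?gt0_muley ?addye ?leey.
have [ng|] := ltP (nX g) +oo; last first.
  rewrite leye_eq => /eqP ->.
  by rewrite poweRyr // addey ?gt0_muley ?addye ?leey.
(* The scale [s^(1/r)] and the tolerance [(e/2)^(1/r)] have [r]-th powers [s] and [e/2]. *)
have a1 : (1 < s `^ r^-1)%R.
  have -> : 1%R = (1 `^ r^-1)%R by rewrite powR1.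
  by rewrite gt0_ltr_powR ?invr_gt0 // ?nnegrE ?ltW.
have e'0 : (0 < (e / 2) `^ r^-1)%R by rewrite powR_gt0 // divr_gt0.
have [G [u' [g' [v [h [[oG EG G1] [mu' mv mg' mh] wg [nu' ng'] vhe]]]]]] :=
  open_enlargement a1 e'0 meas_u u1 ug nu ng.
apply: (@le_trans _ _ (nX (u' \+ v) `^ r + nX (g' \+ h) `^ r)).
  have S0 : 0 <= nX (u' \+ v) `^ r + nX (g' \+ h) `^ r.
    by rewrite adde_ge0 ?poweR_ge0.
  rewrite -[leRHS](poweRe1 S0) -(mulVf rn0) poweRrM; apply: pow_le => //.
  apply: ge_ereal_inf; exists (capacity_r nX r G); first by exists G.
  apply: ereal_inf_lbound; exists (u' \+ v, g' \+ h) => //.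
  by split => //; exact: emeasurable_funD.
apply: le_trans (leeD (nX_r _ _ mu' mv) (nX_r _ _ mg' mh)) _.
have aK : (s `^ r^-1)%:E `^ r = s%:E.
  by rewrite poweR_EFin -powRrM mulVf // powRr1 // ltW.
have nv0 := qnorm_ge0 nX_lattice mv.
have nh0 := qnorm_ge0 nX_lattice mh.
(* Applied to [nX v] and to [nX h], each below their sum; the two halves add up to [e]. *)
have small x : 0 <= x -> x <= nX v + nX h -> x `^ r <= (e / 2)%:E.
  move=> x0 xvh; apply: (@le_trans _ _ (((e / 2) `^ r^-1)%:E `^ r)).
    by apply: pow_le => //; exact: le_trans xvh (ltW vhe).
  by rewrite poweR_EFin -powRrM mulVf // powRr1 // ltW // divr_gt0.
have scaled x y : 0 <= x -> 0 <= y -> x <= (s `^ r^-1)%:E * y ->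
    x `^ r <= s%:E * y `^ r.
  move=> x0 y0 xy; rewrite -aK -poweRM ?lee_fin ?powR_ge0 //.
  exact: pow_le.
rewrite addeACA (splitr e) EFinD leeD //.
- rewrite ge0_muleDr ?poweR_ge0 // leeD //; apply: scaled => //.
  + exact: qnorm_ge0 nX_lattice _ mu'.
  + by rewrite ng' mule_ge0 // lee_fin powR_ge0.
  + by rewrite ng'.
- by rewrite leeD // small // ?leeDl ?leeDr.
Qed.

End open_enlargement.

Local Close Scope ereal_scope.

Theorem proposition4p8 (d : measure_display) (R : realType)
    (P : metricMeasurableType d R) (mu : {measure set P -> \bar R})
    (mu_sigma_finite : sigma_finite setT mu)
    (mu_borel_regular : borel_regular mu)
    (mu_balls : balls_finite_positive mu)
    (c r : R) (nX : (P -> \bar R) -> \bar R)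
    (nX_lattice : quasi_Banach_function_lattice mu c nX)
    (r_gt0 : 0 < r) (nX_r_normed : r_normed nX r)
    (N1_quasicontinuous : forall u, N1 nX u -> quasicontinuous nX u) :
  outer_capacity (capacity_r nX r) /\
  (normed nX -> outer_capacity (capacity nX)).
Proof.
split.
- exact: capacity_r_outer mu_borel_regular nX_lattice N1_quasicontinuous
    _ r_gt0 nX_r_normed.
- exact: capacity_outer mu_borel_regular nX_lattice N1_quasicontinuous.
Qed.
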